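(* Let $f:X\to Y$ be a continuous map between locally compact Hausdorff spaces, let $(A,\rho,\mathbb{B})=(RC(X),\rho_X,CR(X))$, $(B,\eta,\mathbb{B}')=(RC(Y),\rho_Y,CR(Y))$, and let $\varphi=\Lambda^t(f):B\to A$ be given by $\varphi(G)=\mathrm{cl}(f^{-1}(\mathrm{int}(G)))$. Then $f$ is a surjection iff $\varphi$ satisfies the following condition: (SuHLC) for any bounded ultrafilter $v$ in $(B,\eta,\mathbb{B}')$ there exists a bounded ultrafilter $u$ in $(A,\rho,\mathbb{B})$ such that for all $b\in\mathbb{B}'$: $b\,\eta\, v$ holds if and only if for all $b'\in\mathbb{B}'$, $b\ll_\eta b'$ implies $\varphi(b')\,\rho\, u$.
   Context: For a space $X$, $RC(X)$ is the complete Boolean algebra of regular closed subsets of $X$ (those $F$ with $F=\mathrm{cl}(\mathrm{int}(F))$), ordered by inclusion, with $F\vee G=F\cup G$, $F\wedge G=\mathrm{cl}(\mathrm{int}(F\cap G))$, $F^*=\mathrm{cl}(X\setminus F)$; $CR(X)$ is the ideal of compact regular closed subsets; and $F\,\rho_X\,G$ iff $F\cap G\neq\emptyset$. In $(B,\eta,\mathbb{B}')$, $a\ll_\eta b$ means that $a\,\eta\, b^*$ fails; for $B=RC(Y)$ this means $a\subseteq\mathrm{int}(b)$. A bounded ultrafilter in $(B,\eta,\mathbb{B}')$ is an ultrafilter $v$ of the Boolean algebra $B$ with $v\cap\mathbb{B}'\neq\emptyset$ (similarly for $(A,\rho,\mathbb{B})$). For an element $b$ and a set $v$, $b\,\eta\,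 v$ means $b\,\eta\, c$ for all $c\in v$ (similarly for $\rho$). *)

(* Defs.v *)
From HB Require Import structures.
From mathcomp Require Import all_boot all_order all_classical topology.

Set Implicit Arguments.
Unset Strict Implicit.
Unset Printing Implicit Defensive.

Import Order.TTheory.

Local Open Scope classical_set_scope.

Fact regclosed_display : Order.disp_t. Proof. by []. Qed.

Record rcset (X : topologicalType) := RCSet {
  rcset_val :> set X;
  rcset_subproof : `[< regclosed rcset_val >]
}.

HB.instance Definition _ (X : topologicalType) :=
  [isSub for @rcset_val X].
HB.instance Definition _ (X : topologicalType) := [Choice of rcset X by <:].

Section RegularClosedAlgebra.
Context {X : topologicalType}.
Implicit Types (F G H : rcset X) (A B O : set X).

Lemma rcsetP F : closure (F : set X)° = F.
Proof. by case: F => F /= /asboolP. Qed.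

Lemma rcset_closed F : closed (F : set X).
Proof. by rewrite -rcsetP; exact: closed_closure. Qed.

Lemma rcset_eq F G : (F : set X) = G -> F = G.
Proof. exact: val_inj. Qed.

Lemma asbool_closure_open O : open O -> `[< regclosed (closure O) >].
Proof. by move=> oO; apply/asboolP; exact: closure_open_regclosed. Qed.

Definition rcset_closure O (oO : open O) : rcset X :=
  RCSet (asbool_closure_open oO).

Definition rc_bot : rcset X := rcset_closure open0.

Definition rc_top : rcset X := rcset_closure openT.

Lemma regclosedU F G : `[< regclosed ((F : set X) `|` G) >].
Proof.
apply/asboolP; rewrite /regclosed eqEsubset; split.
  rewrite [X in _ `<=` X](closure_id _).1; last first.
    by apply: closedU; exact: rcset_closed.
  by apply: closureS; exact: interior_subset.
apply: (@subset_trans _ (closure (F : set X)° `|` closure (G : set X)°)).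
  by rewrite !rcsetP.
by rewrite -closureU; apply: closureS; exact: interiorU.
Qed.

Definition rc_join F G : rcset X := RCSet (regclosedU F G).

Definition rc_meet F G : rcset X :=
  rcset_closure (open_interior ((F : set X) `&` G)).

Definition rc_compl F : rcset X :=
  rcset_closure (closed_openC (@rcset_closed F)).

Definition rc_le F G : bool := `[< (F : set X) `<=` G >].

Fact rc_le_refl : reflexive rc_le.
Proof. by move=> F; apply/asboolP. Qed.

Fact rc_le_anti : antisymmetric rc_le.
Proof.
move=> F G /andP[/asboolP FG /asboolP GF].
by apply: rcset_eq; rewrite eqEsubset.
Qed.

Fact rc_le_trans : transitive rc_le.
Proof.
move=> G F H /asboolP FG /asboolP GH; apply/asboolP.
exact: subset_trans FG GH.
Qed.

HB.instance Definition _ := Order.Le_isPOrder.Build regclosed_display (rcset X)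
  rc_le_refl rc_le_anti rc_le_trans.

Fact rc_meetP F G H : (F <= rc_meet G H)%O = (F <= G)%O && (F <= H)%O.
Proof.
apply/idP/andP => [/asboolP FGH|[/asboolP FG /asboolP FH]].
  have sub K : (G : set X) `&` H `<=` (K : rcset X) -> (F <= K)%O.
    move=> GHK; apply/asboolP; apply: subset_trans FGH _ => /=.
    by rewrite -(rcsetP K); apply: closureS; exact: interiorS.
  by split; apply: sub => x [].
apply/asboolP => /=; rewrite -{1}(rcsetP F); apply: closureS.
by apply: interiorS => x Fx; split; [exact: FG|exact: FH].
Qed.

Fact rc_joinP F G H : (rc_join F G <= H)%O = (F <= H)%O && (G <= H)%O.
Proof.
apply/idP/andP => [/asboolP FGH|[/asboolP FH /asboolP GH]].
  by split; apply/asboolP => x Fx; apply: FGH; [left|right].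
by apply/asboolP => x [/FH|/GH].
Qed.

HB.instance Definition _ :=
  Order.POrder_MeetJoin_isLattice.Build regclosed_display (rcset X)
    rc_meetP rc_joinP.

Lemma closure_interiorU_closed A B : closed A -> closed B ->
  closure (A `|` B)° `<=` closure A° `|` closure B°.
Proof.
move=> cA cB.
have sub : (A `|` B)° `<=` closure A° `|` B.
  apply: subset_trans (_ : A° `|` B `<=` _); last first.
    by apply: setSU; exact: subset_closure.
  move=> x ABx; have [Bx|nBx] := pselect (B x); [by right|left].
  have oO : open ((A `|` B)° `&` ~` B).
    by apply: openI; [exact: open_interior|exact: closed_openC].
  suff: ((A `|` B)° `&` ~` B) `<=` A°.
    by apply; split.
  rewrite -open_subsetE// => y [/interior_subset[]//].
rewrite -closureU => x clx U Ux; have [y [ABy Uy]] := clx _ (nbhs_interior Ux).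
have [cAy|ncAy] := pselect (closure A° y).
  have [z [Az Uz]] := cAy _ Uy.
  by exists z; split; [left|].
exists y; split; last exact: interior_subset.
right.
suff: ((A `|` B)° `&` ~` closure A°) `<=` B° by apply; split.
rewrite -open_subsetE; last first.
  by apply: openI; [exact: open_interior|rewrite openC; exact: closed_closure].
by move=> z [/sub[]].
Qed.

Fact rc_meetUl : @left_distributive (rcset X) (rcset X) Order.meet Order.join.
Proof.
move=> F G H; apply/le_anti/andP; split; last first.
  by rewrite leUx !leI2 ?leUl ?leUr.
apply/asboolP => /=; rewrite setIUl; apply: closure_interiorU_closed;
  by apply: closedI; exact: rcset_closed.
Qed.

HB.instance Definition _ :=
  Order.Lattice_Meet_isDistrLattice.Build regclosed_display (rcset X)
    rc_meetUl.

Fact rc_le0x F : (rc_bot <= F)%O.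
Proof. by apply/asboolP => /=; rewrite closure0. Qed.

Fact rc_lex1 F : (F <= rc_top)%O.
Proof. by apply/asboolP => /=; rewrite closureT. Qed.

HB.instance Definition _ :=
  Order.hasBottom.Build regclosed_display (rcset X) rc_le0x.
HB.instance Definition _ :=
  Order.hasTop.Build regclosed_display (rcset X) rc_lex1.

Fact rc_joinxC F : Order.join F (rc_compl F) = Order.top.
Proof.
apply: rcset_eq; rewrite /= closureT eqEsubset; split=> // x _.
by have [Fx|nFx] := pselect ((F : set X) x); [left|right; exact: subset_closure].
Qed.

Fact rc_meetxC F : Order.meet F (rc_compl F) = Order.bottom.
Proof.
apply: rcset_eq; rewrite /= interiorI closure_setC interiorC rcsetP.
by rewrite closure0 (_ : _ `&` _ = set0) ?closure0// -subset0 => x [/interior_subset].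
Qed.

HB.instance Definition _ :=
  Order.TBDistrLattice_hasComplement.Build regclosed_display (rcset X)
    rc_joinxC rc_meetxC.

(* The ideal CR(X). *)
Definition compact_rc : set (rcset X) := [set F | compact (F : set X)].

(* The contact relation rho_X. *)
Definition rc_contact F G : Prop := (F : set X) `&` G !=set0.

End RegularClosedAlgebra.

Section LocalContact.
Context {d : Order.disp_t} {B : ctbDistrLatticeType d}.
Implicit Types (v : set B) (eta : B -> B -> Prop) (a b c : B).

Definition proper_filter v : Prop :=
  [/\ v \top%O, ~ v \bot%O,
      forall a b, v a -> v b -> v (a `&` b)%O &
      forall a b, (a <= b)%O -> v a -> v b].

Definition ultrafilter v : Prop :=
  proper_filter v /\ forall w, proper_filter w -> v `<=` w -> w = v.

Definition bounded_ultrafilter (bounded : set B) v : Prop :=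
  ultrafilter v /\ v `&` bounded !=set0.

Definition well_inside eta a b : Prop := ~ eta a (~` b)%O.

Definition contact_all eta b v : Prop := forall c, v c -> eta b c.

End LocalContact.

Lemma rc_well_insideE (X : topologicalType) (F G : rcset X) :
  well_inside rc_contact F G <-> (F : set X) `<=` (G : set X)°.
Proof.
rewrite /well_inside /rc_contact /= closure_setC; split=> [nFG x Fx|FG].
  by apply: contrapT => nGx; apply: nFG; exists x.
by case=> x [/FG].
Qed.

Definition SuHLC {d d' : Order.disp_t}
    {A : ctbDistrLatticeType d} {B : ctbDistrLatticeType d'}
    (rho : A -> A -> Prop) (boundedA : set A)
    (eta : B -> B -> Prop) (boundedB : set B) (phi : B -> A) : Prop :=
  forall v : set B, bounded_ultrafilter boundedB v ->
  exists2 u : set A, bounded_ultrafilter boundedA u &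
    forall b, boundedB b ->
      (contact_all eta b v <->
       forall b', boundedB b' -> well_inside eta b b' ->
         contact_all rho (phi b') u).

Section DualMap.
Context {X Y : topologicalType} (f : X -> Y) (cf : continuous f).

Lemma open_preimage_interior (G : rcset Y) : open (f @^-1` (G : set Y)°).
Proof. by apply: open_comp; [move=> x _; exact: cf|exact: open_interior]. Qed.

(* Lambda^t(f) : G |-> cl (f^-1 (int G)); continuity of f is what makes the
   value regular closed. *)
Definition dual_map (G : rcset Y) : rcset X :=
  rcset_closure (open_preimage_interior G).

End DualMap.

(* Main.v *)
Require Import Defs.
From mathcomp Require Import all_boot all_order all_classical topology.

Set Implicit Arguments.
Unset Strict Implicit.
Unset Printing Implicit Defensive.

Import Order.Theory.

Local Open Scope classical_set_scope.

(** In a locally compact Hausdorff space, (SuHLC) is surjectivity read through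
    the correspondence between bounded ultrafilters of regular closed sets and
    points.

    A bounded ultrafilter [v] has a compact member, so its members, which form
    a filter base of closed sets, share a point [x]. Every regular closed
    neighborhood of [x] belongs to [v] (its complement misses [x]), and these
    neighborhoods are arbitrarily small; hence [F] is in contact with all of
    [v] exactly when [x] is in [F] ([bounded_ultrafilter_point]). Conversely
    the sets whose interior contains [x] form a proper filter, and any
    ultrafilter above it represents [x] in this sense
    ([point_bounded_ultrafilter]).

    Let [v] represent [y] and [u] represent [x]. The left-hand side of (SuHLC)
    at [b] then says that [y] is in [b], and the right-hand side that [x] is in
    the closure of the preimage of the interior of [b'] for every compact
    regular closed neighborhood [b'] of [b]. As such [b'] shrink to [b], this
    amounts to [f x] being in [b] ([dual_map_well_insideP]). Compact regular
    closed sets separate points, so the equivalence for all [b] means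
    [y = f x]. Thus (SuHLC) asserts that each [y] is the image of some [x]. *)

(** * Ultrafilters in a Boolean algebra *)

(** Zorn's lemma: the union of a nonempty chain of proper filters is a proper
    filter. *)
Lemma ultrafilter_extension {d : Order.disp_t} {B : ctbDistrLatticeType d}
    (w : set B) :
  proper_filter w -> exists2 v, ultrafilter v & w `<=` v.
Proof.
move=> pw.
(* The empty set is admitted so that the union of the empty chain is in P. *)
pose P := [set v : set B | v = set0 \/ proper_filter v /\ w `<=` v].
have chainP (C : set (set B)) :
    C `<=` P -> total_on C subset -> P (\bigcup_(v in C) v).
  move=> CP Ctot.
  have CPne v a : C v -> v a -> proper_filter v /\ w `<=` v.
    by move=> /CP[->|].
  have [[v0 [Cv0 [a0 v0a0]]]|noC] :=
      pselect (exists v, C v /\ exists a, v a); last first.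
    left; rewrite -subset0 => a [v Cv va]; apply: noC.
    by exists v; split=> //; exists a.
  right; have [[top0 _ _ _] wv0] := CPne _ _ Cv0 v0a0.
  split; last by move=> a wa; exists v0 => //; exact: wv0.
  split.
  - by exists v0.
  - by case=> v Cv vbot; have [[_ /(_ vbot)]] := CPne _ _ Cv vbot.
  - move=> a b [v Cv va] [v' Cv' v'b].
    have [[_ _ meetv _] _] := CPne _ _ Cv va.
    have [[_ _ meetv' _] _] := CPne _ _ Cv' v'b.
    have [vv'|v'v] := Ctot _ _ Cv Cv'.
      by exists v' => //; apply: meetv' => //; exact: vv'.
    by exists v => //; apply: meetv => //; exact: v'v.
  - move=> a b ab [v Cv va]; have [[_ _ _ upv] _] := CPne _ _ Cv va.
    by exists v => //; exact: upv va.
have [v [Pv vmax]] := Zorn_bigcup chainP.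
have [pv wv] : proper_filter v /\ w `<=` v.
  case: Pv => // v0; exfalso; apply: (vmax w); last by right; split.
  have [wtop _ _ _] := pw.
  by rewrite v0; split=> // /(_ _ wtop).
exists v => //; split=> // u pu vu; apply/esym/seteqP; split=> // a ua.
apply: contrapT => nva; apply: (vmax u).
  by split=> // /(_ _ ua).
by right; split=> //; exact: subset_trans vu.
Qed.

(** If [v] omits [a], then no element of [v] lies below [a], so that [v] and
    the complement of [a] generate a proper filter; by maximality it is [v]. *)
Lemma ultrafilter_compl {d : Order.disp_t} {B : ctbDistrLatticeType d}
    (v : set B) (a : B) :
  ultrafilter v -> ~ v a -> v (~` a)%O.
Proof.
move=> [[vtop nvbot vI vup] vmax] nva.
pose u : set B := [set b | exists2 c, v c & (c `&` ~` a <= b)%O].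
suff pu : proper_filter u.
  rewrite -(vmax u pu); first by exists \top%O => //; rewrite leIr.
  by move=> b vb; exists b => //; rewrite leIl.
split.
- by exists \top%O => //; exact: lex1.
- move=> [c vc]; rewrite lex0 -diffE diff_eq0 => ca; apply: nva; exact: vup vc.
- move=> b b' [c vc cb] [c' vc' cb']; exists (c `&` c')%O; first exact: vI.
  rewrite lexI; apply/andP; split.
    by apply: le_trans cb; rewrite leI2// leIl.
  by apply: le_trans cb'; rewrite leI2// leIr.
- by move=> b b' bb' [c vc cb]; exists c => //; exact: le_trans bb'.
Qed.

(** * Compact regular closed neighborhoods *)

(** Regularity gives a neighborhood [V] of [x] whose closure lies in [U] and in
    a compact set; the closure of the interior of [V] is regular closed and
    still has [x] in its interior. *)
Lemma compact_rc_nbhs (X : topologicalType)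
    (lcX : locally_compact [set: X]) (hX : hausdorff_space X)
    (x : X) (U : set X) :
  nbhs x U ->
  exists F : rcset X, [/\ compact_rc F, (F : set X)° x & (F : set X) `<=` U].
Proof.
move=> xU.
have [K] := lcX x I; rewrite withinET => xK [cK _].
have [V xV clVUK] := compact_regular hX cK xK (filterI xU xK).
exists (rcset_closure (open_interior V)).
have FUK : closure V° `<=` U `&` K.
  by apply: subset_trans clVUK; apply: closureS; exact: interior_subset.
split => /=.
- apply: (subclosed_compact _ cK); first exact: closed_closure.
  by move=> z /FUK[].
- by apply: filterS (nbhs_interior xV); exact: subset_closure.
- by move=> z /FUK[].
Qed.

(** The compact regular closed sets avoiding [p] are directed upwards by finite
    joins. Each point of [K] is interior to one of them, hence also to all the
    larger ones, and compactness of [K], in its near-covering form for the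
    filter of tails of this directed family, yields one set for all of [K]. *)
Lemma compact_rc_separation (X : topologicalType)
    (lcX : locally_compact [set: X]) (hX : hausdorff_space X)
    (K : set X) (p : X) : compact K -> ~ K p ->
  exists F : rcset X,
    [/\ compact_rc F, K `<=` (F : set X)° & ~ (F : set X) p].
Proof.
move=> /compact_near_coveringP cK nKp.
pose good := [set F : rcset X | compact_rc F /\ ~ (F : set X) p].
pose tails : set_system (rcset X) := filter_from good
  (fun F => [set G | good G /\ (F : set X) `<=` G]).
have filter_tails : Filter tails.
  apply: filter_from_filter.
    exists rc_bot; split; rewrite /compact_rc /= closure0//.
    exact: compact0.
  move=> F G [cF nFp] [cG nGp]; exists (Order.join F G).
    by split=> [|[]//]; exact: compactU.
  by move=> H [gH FGH]; split; split=> // z Fz; apply: FGH; [left|right].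
have [z Kz|F [cF nFp] FK] := cK _ tails (fun F z => (F : set X)° z) _.
  have [F [cF Fz Fp]] : exists F : rcset X,
      [/\ compact_rc F, (F : set X)° z & (F : set X) `<=` ~` [set p]].
    apply: compact_rc_nbhs => //.
    apply: open_nbhs_nbhs; split; last by move=> zp; apply: nKp; rewrite -zp.
    apply: closed_openC; apply: compact_closed => //; exact: compact_set1.
  exists ((F : set X)°, [set G | good G /\ (F : set X) `<=` G]).
    split; first exact: nbhs_interior.
    by exists F => //; split=> // /Fp; exact.
  by move=> [y G] [/= Fy [_ FG]]; exact: interiorS FG _ Fy.
by exists F; split=> //; have /(_ F) := FK; apply; split.
Qed.

(** * Bounded ultrafilters and points *)

Lemma rcset_le_subset (X : topologicalType) (F G : rcset X) :
  (F <= G)%O -> (F : set X) `<=` G.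
Proof. by move=> /asboolP. Qed.

Section UltrafilterPoint.
Context {X : topologicalType}.
Hypotheses (lcX : locally_compact [set: X]) (hX : hausdorff_space X).

(** The meet of two members lies in their intersection, so the members form a
    filter base; it clusters in the compact member of [v], and a cluster point
    lies in every member because members are closed. *)
Lemma bounded_ultrafilter_cluster (v : set (rcset X)) :
  bounded_ultrafilter compact_rc v ->
  exists x, forall F : rcset X, v F -> (F : set X) x.
Proof.
move=> [[[vtop nvbot vI vup] _] [K [vK cK]]].
have vF : ProperFilter (filter_from v (fun F : rcset X => F : set X)).
  apply: filter_from_proper.
    apply: filter_from_filter; first by exists \top%O.
    move=> F G vF vG; exists (Order.meet F G); first exact: vI.
    by rewrite subsetI; split; apply: rcset_le_subset; [exact: leIl|exact: leIr].
  move=> F vF; apply/set0P/eqP => F0; apply: nvbot.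
  have <- : F = \bot%O by apply: rcset_eq; rewrite F0 /= closure0.
  by [].
have [|x [_ clx]] := cK _ vF; first by exists K.
exists x => F vF'; have := clx; rewrite clusterE => /(_ F).
rewrite -(closure_id _).1; last exact: rcset_closed.
by apply; exists F.
Qed.

(** If [x] is outside [F], it has a regular closed neighborhood [G] disjoint
    from [F]. The complement of [G] misses [x], so it is not in [v]; hence [G]
    is in [v] and witnesses that [F] is not in contact with all of [v]. *)
Lemma contact_all_point (v : set (rcset X)) (x : X) :
  ultrafilter v -> (forall F : rcset X, v F -> (F : set X) x) ->
  forall F : rcset X, contact_all rc_contact F v <-> (F : set X) x.
Proof.
move=> uv vx F; split=> [Fv|Fx G vG]; last by exists x; split=> //; exact: vx.
apply: contrapT => nFx.
have [|G [_ Gx GF]] := @compact_rc_nbhs _ lcX hX x (~` (F : set X)).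
  by apply: open_nbhs_nbhs; split=> //; apply: closed_openC; exact: rcset_closed.
have vG : v G.
  apply: contrapT => /(ultrafilter_compl uv)/vx /=.
  by rewrite closure_setC; exact.
by have [z [Fz /GF]] := Fv _ vG.
Qed.

(** With [point_bounded_ultrafilter], this identifies bounded ultrafilters, up
    to the contact that they induce, with the points of [X]. *)
Lemma bounded_ultrafilter_point (v : set (rcset X)) :
  bounded_ultrafilter compact_rc v ->
  exists x, forall F : rcset X, contact_all rc_contact F v <-> (F : set X) x.
Proof.
move=> bv; have [x vx] := bounded_ultrafilter_cluster bv.
by exists x; apply: contact_all_point => //; case: bv.
Qed.

(** Any ultrafilter [v] above the sets with [x] in their interior works: if a
    member [F] missed [x], then [x] would be interior to the complement of [F],
    which would thus be in [v] as well. *)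
Lemma point_bounded_ultrafilter (x : X) :
  exists2 v : set (rcset X), bounded_ultrafilter compact_rc v &
    forall F : rcset X, contact_all rc_contact F v <-> (F : set X) x.
Proof.
have pw : proper_filter [set F : rcset X | (F : set X)° x].
  split=> /=.
  - by rewrite closureT interiorT.
  - by rewrite closure0 interior0.
  - move=> F G Fx Gx; have FGx : nbhs x ((F : set X) `&` G) by exact: filterI.
    by apply: filterS (nbhs_interior FGx); exact: subset_closure.
  - by move=> F G /asboolP FG; exact: interiorS.
have [v uv wv] := ultrafilter_extension pw.
have [[_ nvbot vI _] _] := uv.
exists v.
  split=> //; have [F [cF Fx _]] := compact_rc_nbhs lcX hX (@filterT _ (nbhs x) _).
  by exists F; split=> //; exact: wv.
apply: contact_all_point => // F vF; apply: contrapT => nFx; apply: nvbot.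
rewrite -(meetxC F); apply: vI => //; apply: wv => /=.
apply: (filterS (@subset_closure _ _)); apply: open_nbhs_nbhs; split=> //.
by apply: closed_openC; exact: rcset_closed.
Qed.

End UltrafilterPoint.

(** * The dual map and the points of the codomain *)

(** This computes the right-hand side of (SuHLC) when contact with [u] is
    membership of [x]. The value of the dual map at [G'] lies between the
    preimages of the interior of [G'] and of [G'] itself, and [G] is the
    intersection of its compact regular closed neighborhoods. *)
Lemma dual_map_well_insideP (X Y : topologicalType)
    (lcY : locally_compact [set: Y]) (hY : hausdorff_space Y)
    (f : X -> Y) (cf : continuous f) (x : X) (G : rcset Y) :
  compact_rc G ->
  (forall G', compact_rc G' -> well_inside rc_contact G G' ->
     (dual_map cf G' : set X) x) <-> (G : set Y) (f x).
Proof.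
move=> cG; split=> [Gx|Gfx G' _ /rc_well_insideE GG']; last first.
  by apply: subset_closure; exact: GG'.
apply: contrapT => nGfx.
have [G' [cG' GG' nG'fx]] := compact_rc_separation lcY hY cG nGfx.
have /rc_well_insideE/(Gx _ cG') := GG'.
suff: (dual_map cf G' : set X) `<=` f @^-1` (G' : set Y) by move=> /[apply].
rewrite /= [X in _ `<=` X](closure_id _).1.
  by apply: closureS => z /interior_subset.
by apply: preimage_closed => //; exact: rcset_closed.
Qed.

(** An inclusion between the families of compact regular closed sets through
    the two points is enough, because [x] has such a neighborhood missing
    [y]. *)
Lemma compact_rc_separates_points (X : topologicalType)
    (lcX : locally_compact [set: X]) (hX : hausdorff_space X) (x y : X) :
  (forall F : rcset X, compact_rc F -> (F : set X) x -> (F : set X) y) -> x = y.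
Proof.
move=> xy; apply: contrapT => nxy.
have [|F [cF /interior_subset Fx Fy]] := @compact_rc_nbhs _ lcX hX x (~` [set y]).
  apply: open_nbhs_nbhs; split=> //.
  by apply: closed_openC; apply: compact_closed => //; exact: compact_set1.
exact: Fy (xy F cF Fx) _.
Qed.

Theorem theorem3p15 (X Y : topologicalType)
    (lcX : locally_compact [set: X]) (hX : hausdorff_space X)
    (lcY : locally_compact [set: Y]) (hY : hausdorff_space Y)
    (f : X -> Y) (cf : continuous f) :
  set_surj [set: X] [set: Y] f <->
  SuHLC (@rc_contact X) compact_rc (@rc_contact Y) compact_rc (dual_map cf).
Proof.
split=> [fsurj v bv|su y _].
  have [y vy] := bounded_ultrafilter_point lcY hY bv.
  have [x _ fxy] := fsurj y I.
  have [u bu ux] := point_bounded_ultrafilter lcX hX x.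
  exists u => // G cG; rewrite vy -fxy -(dual_map_well_insideP lcY hY cf x cG).
  by split=> H G' cG' GG'; apply/ux; exact: H.
have [v bv vy] := point_bounded_ultrafilter lcY hY y.
have [u bu uv] := su v bv.
have [x ux] := bounded_ultrafilter_point lcX hX bu.
exists x => //; apply/esym/(compact_rc_separates_points lcY hY) => G cG /vy/(uv G cG) Gu.
by apply/(dual_map_well_insideP lcY hY cf x cG) => G' cG' GG'; apply/ux; exact: Gu.
Qed.
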